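(* Let $k\ge 1$ and let $u_h=u_h(t)\in V_h^k$, $t\in(0,T]$, be a solution of the semi-discrete ultra-weak DG scheme $$i\int_{I_j}(u_h)_t v_h\,dx+\int_{I_j}u_h(v_h)_{xx}\,dx-\hat u_h (v_h)_x^-|_{j+\frac12}+\hat u_h (v_h)_x^+|_{j-\frac12}+\widetilde{(u_h)_x}\,v_h^-|_{j+\frac12}-\widetilde{(u_h)_x}\,v_h^+|_{j-\frac12}+\int_{I_j}f(|u_h|^2)u_hv_h\,dx=0$$ for all $v_h\in V_h^k$ and all $j=1,\dots,N$, with periodic boundary conditions and numerical fluxes (at every cell interface) $$\widetilde{(u_h)_x}=\{(u_h)_x\}+\alpha_1[(u_h)_x]+\beta_1[u_h],\qquad \hat u_h=\{u_h\}+\alpha_2[u_h]+\beta_2[(u_h)_x],$$ where $\alpha_1,\alpha_2,\beta_1,\beta_2\in\mathbb{C}$ are prescribed. Then $u_h$ satisfies the $L^2$ stability condition $$\frac{d}{dt}\int_I|u_h|^2\,dx\le 0$$ if $$\operatorname{Im}\beta_2\ge 0,\qquad \operatorname{Im}\beta_1\le 0,\qquad |\alpha_1+\overline{\alpha_2}|^2\le -4\,\operatorname{Im}\beta_1\,\operatorname{Im}\beta_2 .$$ In particular, when all the parameters $\alpha_1,\alpha_2,\beta_1,\beta_2$ are real, this condition amounts to $\alpha_1+\alpha_2=0$, without any requirement on $\beta_1,\beta_2$.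
   Context: The scheme discretizes the one-dimensional nonlinear Schrödinger equation $iu_t+u_{xx}+f(|u|^2)u=0$ on $I=[a,b]$ with periodic boundary conditions, where $f$ is a given real-valued function and $u$ is complex valued. Mesh: $a=x_{1/2}<x_{3/2}<\dots<x_{N+1/2}=b$, $I_j=(x_{j-1/2},x_{j+1/2})$. The space $V_h^k$ consists of the (complex-valued, possibly discontinuous) functions $v_h$ on $I$ with $v_h|_{I_j}$ a polynomial of degree at most $k$ for $j=1,\dots,N$. At an interface, $v_h^-$ and $v_h^+$ are the limits from the left cell and the right cell respectively (with periodic identification of $x_{1/2}$ and $x_{N+1/2}$); $[v_h]=v_h^+-v_h^-$ and $\{v_h\}=\frac12(v_h^++v_h^-)$. The same notation is used for the piecewise derivative $(v_h)_x$. The subscript $|_{j\pm\frac12}$ means evaluation at $x_{j\pm 1/2}$. *)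

(* Defs.v *)
From Stdlib Require Import Reals.
From Coquelicot Require Import Coquelicot.

Open Scope R_scope.

(* The natural number [j] stands for the interface x_{j+1/2}, 0 <= j <= cells,
   so that the cells are ]node j, node (S j)[ for j < cells. *)
Record mesh (a b : R) := Mesh {
  cells : nat;
  node : nat -> R;
  cells_pos : (1 <= cells)%nat;
  node_first : node 0%nat = a;
  node_last : node cells = b;
  node_lt : forall j : nat, (j < cells)%nat -> node j < node (S j)
}.

Arguments cells {a b} _.
Arguments node {a b} _ _.

Definition in_cell {a b : R} (M : mesh a b) (j : nat) (y : R) : Prop :=
  node M j < y < node M (S j).

(* The values of [v] at the interfaces are unconstrained: they enter none of
   the definitions below except under an integral sign. *)
Definition in_Vh {a b : R} (M : mesh a b) (k : nat) (v : R -> C) : Prop :=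
  forall j : nat, (j < cells M)%nat ->
  exists c : nat -> C, forall y : R, in_cell M j y ->
    v y = sum_n (fun i : nat => (c i * RtoC y ^ i)%C) k.

Definition CInt (g : R -> C) (p q : R) : C :=
  RInt (V := C_R_CompleteNormedModule) g p q.

Definition CDerive (g : R -> C) (y : R) : C :=
  (Derive (fun s => Re (g s)) y, Derive (fun s => Im (g s)) y).

Definition left_lim (g : R -> C) (y : R) : C :=
  iota (fun l : C_R_CompleteNormedModule => filterlim g (at_left y) (locally l)).

Definition right_lim (g : R -> C) (y : R) : C :=
  iota (fun l : C_R_CompleteNormedModule => filterlim g (at_right y) (locally l)).

(* Periodic identification of the interfaces 0 and [cells]. *)
Definition trace_m {a b : R} (M : mesh a b) (w : R -> C) (j : nat) : C :=
  left_lim w (node M (if Nat.eqb j 0 then cells M else j)).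

Definition trace_p {a b : R} (M : mesh a b) (w : R -> C) (j : nat) : C :=
  right_lim w (node M (if Nat.eqb j (cells M) then 0%nat else j)).

Definition jump {a b : R} (M : mesh a b) (w : R -> C) (j : nat) : C :=
  (trace_p M w j - trace_m M w j)%C.

Definition avg {a b : R} (M : mesh a b) (w : R -> C) (j : nat) : C :=
  (RtoC (1 / 2) * (trace_p M w j + trace_m M w j))%C.

Definition flux_ux {a b : R} (M : mesh a b) (alpha1 beta1 : C)
    (w : R -> C) (j : nat) : C :=
  (avg M (CDerive w) j + alpha1 * jump M (CDerive w) j + beta1 * jump M w j)%C.

Definition flux_u {a b : R} (M : mesh a b) (alpha2 beta2 : C)
    (w : R -> C) (j : nat) : C :=
  (avg M w j + alpha2 * jump M w j + beta2 * jump M (CDerive w) j)%C.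

(* Left-hand side of the scheme on ]node j, node (S j)[, for the state [w]
   with time derivative [wt] and the test function [v]. *)
Definition scheme_lhs {a b : R} (M : mesh a b) (f : R -> R)
    (alpha1 alpha2 beta1 beta2 : C) (w wt v : R -> C) (j : nat) : C :=
  (Ci * CInt (fun y => wt y * v y) (node M j) (node M (S j))
   + CInt (fun y => w y * CDerive (CDerive v) y) (node M j) (node M (S j))
   - flux_u M alpha2 beta2 w (S j) * trace_m M (CDerive v) (S j)
   + flux_u M alpha2 beta2 w j * trace_p M (CDerive v) j
   + flux_ux M alpha1 beta1 w (S j) * trace_m M v (S j)
   - flux_ux M alpha1 beta1 w j * trace_p M v j
   + CInt (fun y => RtoC (f (Cmod (w y) ^ 2)%R) * w y * v y)
       (node M j) (node M (S j)))%C.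

(* Derivative along the set [D]: two-sided in its interior, one-sided at an
   end point belonging to [D]. *)
Definition is_derive_within {V : NormedModule R_AbsRing} (D : R -> Prop)
    (g : R -> V) (t : R) (l : V) : Prop :=
  filterdiff g (within D (locally t)) (fun h : R => scal h l).

Definition semidiscrete_solution {a b : R} (M : mesh a b) (k : nat) (T : R)
    (f : R -> R) (alpha1 alpha2 beta1 beta2 : C) (u : R -> R -> C) : Prop :=
  exists ut : R -> R -> C, forall t : R, 0 < t <= T ->
    in_Vh M k (u t) /\
    (forall (j : nat) (y : R), (j < cells M)%nat -> in_cell M j y ->
       is_derive_within (V := C_R_NormedModule) (fun s => 0 < s <= T)
         (fun s => u s y) t (ut t y)) /\
    (forall v : R -> C, in_Vh M k v -> forall j : nat, (j < cells M)%nat ->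
       scheme_lhs M f alpha1 alpha2 beta1 beta2 (u t) (ut t) v j = RtoC 0).

Definition flux_condition (alpha1 alpha2 beta1 beta2 : C) : Prop :=
  0 <= Im beta2 /\ Im beta1 <= 0 /\
  Cmod (alpha1 + Cconj alpha2)%C ^ 2 <= - 4 * Im beta1 * Im beta2.

Definition L2_stable (a b T : R) (u : R -> R -> C) : Prop :=
  forall t : R, 0 < t <= T ->
  exists d : R,
    is_derive_within (V := R_NormedModule) (fun s => 0 < s <= T)
      (fun s => RInt (fun y => Cmod (u s y) ^ 2) a b) t d /\
    d <= 0.

(* Main.v *)
Require Import Defs.
From Stdlib Require Import Reals Lra Lia Classical.
From Coquelicot Require Import Coquelicot.

(** Test the scheme on each cell with the conjugate of [u_h] and take imaginary
    parts: the nonlinear term is real, and [Im (u conj(u)_xx)] is the derivative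
    of [Im (u conj(u)_x)], so half the time derivative of the cell energy is a
    difference of interface terms.  Summing over the cells, the contribution of
    an interface is, up to sign,
      [Im beta2 |[u_x]|^2 - Im beta1 |[u]|^2
       - Im ((alpha1 + conj alpha2) [u_x] conj [u])],
    which the condition on the parameters makes nonnegative.

    The solution is only assumed differentiable in time pointwise in space.
    Lagrange interpolation at fixed points of a cell turns [u_h] into a finite
    sum of products of a function of time and a function of space, which
    justifies differentiating the energy under the integral. *)

(** * Finite sums and Lagrange interpolation *)

Lemma continuous_sum_f_R0 (F : nat -> R -> R) (n : nat) (y : R) :
  (forall i, continuous (F i) y) ->
  continuous (fun z => sum_f_R0 (fun i => F i z) n) y.
Proof.
intros hF; induction n as [|n IH]; simpl; [apply hF|].
apply (continuous_plus (fun z => sum_f_R0 (fun i => F i z) n)); auto.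
Qed.

(* Adding a node [r], the old basis functions are multiplied by
   [(y - r) / (x m - r)], and the new one is [1] minus their sum. *)
Lemma lagrange_basis (x : nat -> R) (n : nat) :
  (forall i j : nat, i <> j -> x i <> x j) ->
  exists l : nat -> R -> R,
    (forall m y, continuous (l m) y) /\
    forall i y, (i <= n)%nat ->
      sum_f_R0 (fun m => l m y * x m ^ i) n = y ^ i.
Proof.
intros hx; induction n as [|n [l [lc hl]]].
- exists (fun _ _ => 1); split.
  + intros m y; apply continuous_const.
  + intros i y hi; replace i with 0%nat by lia; simpl; ring.
- pose (r := x (S n)).
  pose (L := fun m y => (y - r) * l m y / (x m - r)).
  (* Subtracting [r ^ i] removes the new node from the sum. As [x ^ (i+1) - r ^ (i+1) = x ^ i * (x -
     r) + r * (x ^ i - r ^ i)], the factor [x m - r] cancels the denominator of [L], and the old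
     identity is called only in degree at most [n]. *)
  assert (key : forall i y, (i <= S n)%nat ->
            sum_f_R0 (fun m => L m y * (x m ^ i - r ^ i)) n = y ^ i - r ^ i).
  { intros i y; induction i as [|i IH]; intros hi.
    - rewrite (sum_eq _ (fun _ => 0)).
      + rewrite sum_cte; simpl; ring.
      + intros m _; simpl; ring.
    - rewrite (sum_eq _ (fun m => l m y * x m ^ i * (y - r)
                                  + L m y * (x m ^ i - r ^ i) * r)).
      + rewrite sum_plus, <- !scal_sum, hl, IH by lia; simpl; ring.
      + intros m hm; unfold L.
        assert (x m - r <> 0) by (apply Rminus_eq_contra, hx; lia).
        simpl; field; assumption. }
  exists (fun m y => if Nat.eqb m (S n)
                     then 1 - sum_f_R0 (fun i => L i y) n else L m y).
  split.
  + assert (Lc : forall m y, continuous (L m) y).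
    { intros m y; unfold L, Rdiv.
      apply (continuous_mult (fun y => (y - r) * l m y) (fun _ => / (x m - r)));
        [apply (continuous_mult (fun y => y - r) (l m)); [|apply lc]
        |apply continuous_const].
      apply (continuous_minus (fun y : R => y) (fun _ => r));
        [apply continuous_id|apply continuous_const]. }
    intros m y; destruct (Nat.eqb m (S n)); [|apply Lc].
    apply (continuous_minus (fun _ => 1) (fun z => sum_f_R0 (fun i => L i z) n));
      [apply continuous_const|apply continuous_sum_f_R0; auto].
  + intros i y hi; simpl sum_f_R0; rewrite Nat.eqb_refl; fold r.
    rewrite (sum_eq _ (fun m => L m y * (x m ^ i - r ^ i) + L m y * r ^ i)).
    * rewrite sum_plus, key, <- scal_sum by assumption; ring.
    * intros m hm; replace (Nat.eqb m (S n)) with false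
        by (symmetry; apply Nat.eqb_neq; lia); ring.
Qed.

Lemma sum_f_R0_exchange (F : nat -> nat -> R) (n m : nat) :
  sum_f_R0 (fun i => sum_f_R0 (fun j => F i j) m) n
  = sum_f_R0 (fun j => sum_f_R0 (fun i => F i j) n) m.
Proof.
induction n as [|n IH]; simpl; [reflexivity|].
rewrite IH, <- sum_plus; reflexivity.
Qed.

Lemma is_RInt_sum_f_R0 (F : nat -> R -> R) (n : nat) (p q : R) :
  (forall i y, continuous (F i) y) ->
  is_RInt (fun y => sum_f_R0 (fun i => F i y) n) p q
    (sum_f_R0 (fun i => RInt (F i) p q) n).
Proof.
intros hF.
assert (H : forall i, is_RInt (F i) p q (RInt (F i) p q)).
{ intros i; apply (RInt_correct (F i)), (ex_RInt_continuous (F i)); auto. }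
induction n as [|n IH]; simpl; [apply H|].
apply (is_RInt_plus (V := R_NormedModule)); auto.
Qed.

(** * Differentiation along a set of times *)

Section Within.

Variables (D : R -> Prop) (t : R).
Hypothesis Dt : D t.

Instance within_locally_proper : ProperFilter (within D (locally t)).
Proof.
constructor; [|apply within_filter, locally_filter].
intros P [e H]; exists t; apply H; [apply ball_center|exact Dt].
Qed.

Lemma is_filter_lim_within : is_filter_lim (within D (locally t)) t.
Proof. intros P HP; unfold within; apply (filter_imp P); auto. Qed.

(** Agreement on [D] suffices: the filter sees only times in [D], and its only limit point is [t],
    which belongs to [D]. *)
Lemma is_derive_within_ext {V : NormedModule R_AbsRing} (g h : R -> V) (l : V) :
  (forall s, D s -> g s = h s) ->
  is_derive_within D g t l -> is_derive_within D h t l.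
Proof.
intros e; apply filterdiff_ext_loc.
- unfold within; apply filter_forall; exact e.
- intros x hx; replace x with t; [auto|].
  apply (is_filter_lim_unique (F := within D (locally t)) (V := R_NormedModule));
    [apply is_filter_lim_within|exact hx].
Qed.

Lemma is_derive_within_plus (g h : R -> R) (l m : R) :
  is_derive_within (V := R_NormedModule) D g t l ->
  is_derive_within (V := R_NormedModule) D h t m ->
  is_derive_within (V := R_NormedModule) D (fun s => g s + h s) t (l + m).
Proof.
intros hg hh; unfold is_derive_within in *.
refine (filterdiff_ext_lin _ _ _ (filterdiff_plus_fct _ _ _ _ hg hh) _).
intros y; unfold plus, scal; simpl; unfold mult; simpl; ring.
Qed.

Lemma is_derive_within_const (c : R) :
  is_derive_within (V := R_NormedModule) D (fun _ => c) t 0.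
Proof.
refine (filterdiff_ext_lin _ _ _ (filterdiff_const _) _).
intros y; unfold scal, zero; simpl; unfold mult; simpl; ring.
Qed.

(** The differential estimate with constant 1 gives [|g s - g t| <= (1 + |l|) |s - t|] near [t] in
    [D]. The product rule needs this to know that [(g, h)] tends to [(g t, h t)]. *)
Lemma is_derive_within_continuous (g : R -> R) (l : R) :
  is_derive_within (V := R_NormedModule) D g t l ->
  filterlim g (within D (locally t)) (locally (g t)).
Proof.
intros [_ hg]; specialize (hg t is_filter_lim_within (mkposreal 1 Rlt_0_1)).
apply filterlim_locally; intros eps.
assert (hc : 0 < 1 + Rabs l) by (pose proof (Rabs_pos l); lra).
assert (he : 0 < eps / (1 + Rabs l)) by (apply Rdiv_lt_0_compat; [apply cond_pos|exact hc]).
assert (hn : within D (locally t) (fun s => Rabs (s - t) < eps / (1 + Rabs l))).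
{ exists (mkposreal _ he); intros y hy _; exact hy. }
generalize (filter_and _ _ hg hn); apply filter_imp; intros s [h1 h2].
change (Rabs (g s - g t - (s - t) * l) <= 1 * Rabs (s - t)) in h1.
change (Rabs (g s - g t) < eps).
replace (g s - g t) with ((g s - g t - (s - t) * l) + (s - t) * l) by ring.
apply Rle_lt_trans with ((1 + Rabs l) * Rabs (s - t)).
- eapply Rle_trans; [apply Rabs_triang|]; rewrite Rabs_mult; lra.
- apply (Rmult_lt_compat_l (1 + Rabs l)) in h2; [|exact hc].
  replace ((1 + Rabs l) * (eps / (1 + Rabs l))) with (pos eps) in h2 by (field; lra).
  exact h2.
Qed.

Lemma is_derive_within_mult (g h : R -> R) (l m : R) :
  is_derive_within (V := R_NormedModule) D g t l ->
  is_derive_within (V := R_NormedModule) D h t m ->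
  is_derive_within (V := R_NormedModule) D (fun s => g s * h s) t
    (l * h t + g t * m).
Proof.
intros hg hh.
assert (lim : is_filter_lim (filtermap (fun s => (g s, h s)) (within D (locally t)))
                (g t, h t)).
{ intros P HP.
  assert (E := filterlim_pair _ _ (is_derive_within_continuous _ _ hg)
                 (is_derive_within_continuous _ _ hh)).
  apply E; destruct HP as [e He].
  exists (ball (g t) e) (ball (h t) e); try apply locally_ball.
  intros x y h1 h2; apply He; split; assumption. }
refine (filterdiff_ext_lin _ _ _
  (filterdiff_comp_2 g h (fun x y => mult x y) _ _
    (fun x y => plus (mult x (h t)) (mult (g t) y)) hg hh
    (filterdiff_mult (K := R_AbsRing) (g t, h t) lim Rmult_comm)) _).
intros y; unfold plus, scal, mult; simpl; unfold mult; simpl; ring.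
Qed.

Lemma is_derive_within_sum (G : nat -> R -> R) (l : nat -> R) (n : nat) :
  (forall i, (i <= n)%nat -> is_derive_within (V := R_NormedModule) D (G i) t (l i)) ->
  is_derive_within (V := R_NormedModule) D
    (fun s => sum_f_R0 (fun i => G i s) n) t (sum_f_R0 l n).
Proof.
intros H; induction n as [|n IH]; simpl; [apply H; lia|].
apply is_derive_within_plus; [apply IH; intros; apply H|apply H]; lia.
Qed.

Lemma is_derive_within_Re_Im (g : R -> C) (l : C) :
  is_derive_within (V := C_R_NormedModule) D g t l ->
  is_derive_within (V := R_NormedModule) D (fun s => Re (g s)) t (Re l) /\
  is_derive_within (V := R_NormedModule) D (fun s => Im (g s)) t (Im l).
Proof.
intros hg; split.
- refine (filterdiff_ext_lin _ _ _
    (filterdiff_comp g (fun z : C_R_NormedModule => fst z) _ _ hg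
      (filterdiff_linear _ is_linear_fst)) _); reflexivity.
- refine (filterdiff_ext_lin _ _ _
    (filterdiff_comp g (fun z : C_R_NormedModule => snd z) _ _ hg
      (filterdiff_linear _ is_linear_snd)) _); reflexivity.
Qed.

End Within.

(** Every [t] of []0, T]], the end point [T] included, has points of the set arbitrarily close on
    its left. Comparing both expansions at one of them bounds [|l - m|] by any [eps]. *)
Lemma is_derive_within_unique (T t : R) (g : R -> R) (l m : R) :
  0 < t <= T ->
  is_derive_within (V := R_NormedModule) (fun s => 0 < s <= T) g t l ->
  is_derive_within (V := R_NormedModule) (fun s => 0 < s <= T) g t m ->
  l = m.
Proof.
intros ht [_ hl] [_ hm].
assert (lim := is_filter_lim_within (fun s => 0 < s <= T) t).
apply Rminus_diag_uniq, Rabs_eq_0, Rle_antisym; [|apply Rabs_pos].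
apply le_epsilon; intros eps heps.
assert (he2 : 0 < eps / 2) by lra.
specialize (hl t lim (mkposreal _ he2)); specialize (hm t lim (mkposreal _ he2)).
destruct (filter_and _ _ hl hm) as [d hd].
(* The two halves keep [s] within distance [d] of [t] and strictly positive, while [s < t <= T]. *)
pose (s := t - Rmin (d / 2) (t / 2)).
assert (hmin : 0 < Rmin (d / 2) (t / 2)).
{ apply Rmin_case; [|lra]; pose proof (cond_pos d); lra. }
pose proof (Rmin_l (d / 2) (t / 2)); pose proof (Rmin_r (d / 2) (t / 2)).
destruct (hd s) as [h1 h2].
- change (Rabs (s - t) < d); unfold s.
  replace (t - Rmin (d / 2) (t / 2) - t) with (- Rmin (d / 2) (t / 2)) by ring.
  rewrite Rabs_Ropp, Rabs_pos_eq; lra.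
- unfold s; lra.
- change (Rabs (g s - g t - (s - t) * l) <= eps / 2 * Rabs (s - t)) in h1.
  change (Rabs (g s - g t - (s - t) * m) <= eps / 2 * Rabs (s - t)) in h2.
  assert (hs : 0 < Rabs (s - t)) by (apply Rabs_pos_lt; unfold s; lra).
  apply Rmult_le_reg_r with (Rabs (s - t)); [exact hs|].
  rewrite <- Rabs_mult.
  replace ((l - m) * (s - t)) with
    ((g s - g t - (s - t) * m) - (g s - g t - (s - t) * l)) by ring.
  unfold Rminus at 1; eapply Rle_trans; [apply Rabs_triang|].
  rewrite Rabs_Ropp; lra.
Qed.

(** * Energy of a time-dependent polynomial on an interval *)

Lemma RInt_bilinear (l : nat -> R -> R) (a b : nat -> R) (n : nat) (p q : R) :
  (forall m y, continuous (l m) y) ->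
  RInt (fun y => sum_f_R0 (fun i => l i y * a i) n
                 * sum_f_R0 (fun j => l j y * b j) n) p q
  = sum_f_R0 (fun i => sum_f_R0 (fun j =>
      (a i * b j) * RInt (fun y => l i y * l j y) p q) n) n.
Proof.
intros lc.
assert (cc : forall i j y, continuous (fun y => l i y * l j y) y)
  by (intros i j y; apply (continuous_mult (l i) (l j)); auto).
assert (cs : forall i j y, continuous (fun y => (a i * b j) * (l i y * l j y)) y)
  by (intros i j y; apply (continuous_mult (fun _ => a i * b j) (fun y => l i y * l j y));
      [apply continuous_const|apply cc]).
rewrite (RInt_ext (V := R_CompleteNormedModule) _ (fun y => sum_f_R0 (fun i => sum_f_R0 (fun j =>
      (a i * b j) * (l i y * l j y)) n) n)).
- erewrite is_RInt_unique by
    (apply is_RInt_sum_f_R0; intros i y; apply continuous_sum_f_R0; intros j; apply cs).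
  apply sum_eq; intros i _.
  erewrite is_RInt_unique by (apply is_RInt_sum_f_R0; intros j y; apply cs).
  apply sum_eq; intros j _.
  apply (RInt_scal (V := R_CompleteNormedModule) (fun y => l i y * l j y)).
  apply (ex_RInt_continuous (V := R_CompleteNormedModule)); auto.
- intros y _; rewrite Rmult_comm, scal_sum; apply sum_eq; intros i _.
  rewrite scal_sum; apply sum_eq; intros j _; simpl; ring.
Qed.

(** The coefficients [c] carry no regularity in time, so [U] is expressed through its values at
    fixed points, which are differentiable. The energy becomes a quadratic form in these values
    whose matrix, the integrals of [l i * l j], does not depend on time. *)
Lemma polynomial_energy_derivative (T t x0 x1 : R) (k : nat) (U : R -> R -> R) (U' : R -> R) :
  0 < t <= T -> x0 < x1 ->
  (forall s, 0 < s <= T -> exists c : nat -> R, forall y, x0 < y < x1 ->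
     U s y = sum_f_R0 (fun i => c i * y ^ i) k) ->
  (forall y, x0 < y < x1 -> is_derive_within (V := R_NormedModule)
     (fun s => 0 < s <= T) (fun s => U s y) t (U' y)) ->
  exists A : R -> R,
    (forall y, continuous A y) /\
    (forall y, x0 < y < x1 -> U' y = A y) /\
    is_derive_within (V := R_NormedModule) (fun s => 0 < s <= T)
      (fun s => RInt (fun y => U s y ^ 2) x0 x1) t
      (RInt (fun y => 2 * A y * U t y) x0 x1).
Proof.
intros ht hx hU hU'.
(* For [i <= k] these are equally spaced points strictly inside the interval, because the hypotheses
   on [U] say nothing at its end points. *)
pose (X := fun i : nat => x0 + (x1 - x0) * ((INR i + 1) / (INR k + 2))).
assert (hk := pos_INR k).
assert (Xdiff : forall i j, i <> j -> X i <> X j).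
{ intros i j hij e; apply hij, INR_eq; unfold X in e.
  apply Rplus_eq_reg_l, Rmult_eq_reg_l in e; [|lra].
  unfold Rdiv in e; apply Rmult_eq_reg_r in e; [lra|].
  apply Rinv_neq_0_compat; lra. }
assert (Xin : forall i, (i <= k)%nat -> x0 < X i < x1).
{ intros i hi; unfold X; apply le_INR in hi; pose proof (pos_INR i).
  assert (h0 : 0 < (INR i + 1) / (INR k + 2)) by (apply Rdiv_lt_0_compat; lra).
  assert (h1 : (INR i + 1) / (INR k + 2) < 1) by (apply Rlt_div_l; lra).
  nra. }
destruct (lagrange_basis X k Xdiff) as [l [lc hl]].
assert (interp : forall s y, 0 < s <= T -> x0 < y < x1 ->
          U s y = sum_f_R0 (fun m => l m y * U s (X m)) k).
{ intros s y hs hy; destruct (hU s hs) as [c hc].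
  rewrite (sum_eq _ (fun m => sum_f_R0 (fun i => c i * X m ^ i * l m y) k)).
  - rewrite sum_f_R0_exchange, hc by exact hy; apply sum_eq; intros i hi.
    rewrite <- (hl i y hi), scal_sum; apply sum_eq; intros; ring.
  - intros m hm; rewrite hc, scal_sum by (apply Xin; exact hm); reflexivity. }
(* [A] interpolates [U'] at the points [X m]. It equals [U'] in the cell by differentiating [interp]
   at fixed [y] and using uniqueness of the derivative. *)
exists (fun y => sum_f_R0 (fun m => l m y * U' (X m)) k); split; [|split].
- intros y; apply continuous_sum_f_R0; intros m.
  apply (continuous_mult (l m) (fun _ => U' (X m))); [apply lc|apply continuous_const].
- intros y hy.
  apply (is_derive_within_unique T t (fun s => U s y)); [exact ht|auto|].
  apply (is_derive_within_ext _ _ ht (fun s => sum_f_R0 (fun m => l m y * U s (X m)) k)).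
  + intros s hs; symmetry; auto.
  + apply is_derive_within_sum; intros m hm.
    replace (l m y * U' (X m)) with (0 * U t (X m) + l m y * U' (X m)) by ring.
    apply (is_derive_within_mult _ _ ht (fun _ => l m y) (fun s => U s (X m)));
      [apply is_derive_within_const|auto].
- apply (is_derive_within_ext _ _ ht (fun s => sum_f_R0 (fun i => sum_f_R0 (fun j =>
      (U s (X i) * U s (X j)) * RInt (fun y => l i y * l j y) x0 x1) k) k)).
  + intros s hs.
    rewrite <- (RInt_bilinear l (fun i => U s (X i)) (fun j => U s (X j))) by exact lc.
    apply (RInt_ext (V := R_CompleteNormedModule)); intros y.
    rewrite Rmin_left, Rmax_right by lra; intros hy.
    rewrite (interp s y hs hy); simpl; ring.
  (* The derivative is first put in the shape given by the product rule; the vanishing last term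
     comes from the constant integral factor. *)
  + replace (RInt _ x0 x1) with (sum_f_R0 (fun i => sum_f_R0 (fun j =>
      (U' (X i) * U t (X j) + U t (X i) * U' (X j))
        * RInt (fun y => l i y * l j y) x0 x1
      + (U t (X i) * U t (X j)) * 0) k) k).
    * apply is_derive_within_sum; intros i hi; apply is_derive_within_sum; intros j hj.
      apply (is_derive_within_mult _ _ ht (fun s => U s (X i) * U s (X j)) (fun _ => _));
        [apply (is_derive_within_mult _ _ ht (fun s => U s (X i)) (fun s => U s (X j))); auto
        |apply is_derive_within_const].
    * transitivity (sum_f_R0 (fun i => sum_f_R0 (fun j =>
          (U' (X i) * U t (X j)) * RInt (fun y => l i y * l j y) x0 x1) k) k
        + sum_f_R0 (fun i => sum_f_R0 (fun j =>
          (U t (X i) * U' (X j)) * RInt (fun y => l i y * l j y) x0 x1) k) k).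
      { rewrite <- sum_plus; apply sum_eq; intros i _.
        rewrite <- sum_plus; apply sum_eq; intros j _; ring. }
      rewrite <- (RInt_bilinear l (fun i => U' (X i)) (fun j => U t (X j))) by exact lc.
      rewrite <- (RInt_bilinear l (fun i => U t (X i)) (fun j => U' (X j))) by exact lc.
      assert (cs : forall (a : nat -> R) y,
                continuous (fun y => sum_f_R0 (fun m => l m y * a m) k) y).
      { intros a y; apply continuous_sum_f_R0; intros m.
        apply (continuous_mult (l m) (fun _ => a m)); [apply lc|apply continuous_const]. }
      assert (ce : forall a b : nat -> R,
                ex_RInt (fun y => sum_f_R0 (fun m => l m y * a m) k
                                  * sum_f_R0 (fun m => l m y * b m) k) x0 x1).
      { intros a b; apply (ex_RInt_continuous (V := R_CompleteNormedModule)); intros z _.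
        apply (continuous_mult (fun y => sum_f_R0 (fun m => l m y * a m) k)
                 (fun y => sum_f_R0 (fun m => l m y * b m) k)); apply cs. }
      refine (eq_trans (eq_sym (RInt_plus (V := R_CompleteNormedModule) _ _ _ _
        (ce (fun i => U' (X i)) (fun i => U t (X i)))
        (ce (fun i => U t (X i)) (fun i => U' (X i))))) _).
      apply (RInt_ext (V := R_CompleteNormedModule)); intros y.
      rewrite Rmin_left, Rmax_right by lra; intros hy.
      rewrite (interp t y ht hy); unfold plus; simpl; ring.
Qed.

(** * Complex-valued functions through their real and imaginary parts *)

Lemma Re_sum_n (c : nat -> C) (y : R) (n : nat) :
  Re (sum_n (fun i => c i * RtoC y ^ i)%C n) = sum_f_R0 (fun i => Re (c i) * y ^ i) n /\
  Im (sum_n (fun i => c i * RtoC y ^ i)%C n) = sum_f_R0 (fun i => Im (c i) * y ^ i) n.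
Proof.
induction n as [|n [IHr IHi]].
- rewrite sum_O; unfold Re, Im; simpl; split; ring.
- rewrite sum_Sn; simpl sum_f_R0; rewrite <- IHr, <- IHi, <- RtoC_pow.
  unfold plus, Re, Im; simpl; split; ring.
Qed.

(** [R_complete_lim F] is the supremum of the [x] such that [F] holds of the unit ball around
    [x + 1]. Here it is [p_infty], which [real] sends to 0. This gives the default value of an
    undefined integral. *)
Lemma R_complete_lim_full (F : (R -> Prop) -> Prop) :
  (forall P, F P) -> R_complete_lim F = 0.
Proof.
intros hF; unfold R_complete_lim.
assert (E : Lub_Rbar (fun x => F (ball (x + 1) (mkposreal 1 Rlt_0_1))) = p_infty).
{ apply is_lub_Rbar_unique; split; [intros x _; exact I|].
  intros [b| |] hb; simpl; auto.
  - specialize (hb (b + 1) (hF _)); simpl in hb; lra.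
  - exact (hb 0 (hF _)). }
etransitivity; [exact (f_equal real E)|reflexivity].
Qed.

(* When [g] is not integrable, [CInt] is [iota] of the empty predicate, which
   evaluates to [0]. *)
Lemma CInt_real (g : R -> C) (p q : R) :
  (forall y, Im (g y) = 0) -> Im (CInt g p q) = 0.
Proof.
intros hg; unfold CInt.
destruct (classic (exists l : C, is_RInt (V := C_R_NormedModule) g p q l)) as [[l hl]|hn].
- rewrite (is_RInt_unique (V := C_R_CompleteNormedModule) g p q l hl).
  assert (h := is_RInt_fct_extend_snd (U := R_NormedModule) (V := R_NormedModule) g p q l hl).
  change (snd l) with (Im l) in h; rewrite <- (is_RInt_unique (V := R_CompleteNormedModule) _ _ _ _ h).
  rewrite (RInt_ext (V := R_CompleteNormedModule) _ (fun _ => 0)) by (intros; apply hg).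
  rewrite (RInt_const (V := R_CompleteNormedModule)).
  unfold scal; simpl; unfold mult; simpl; ring.
- unfold RInt, iota; simpl; unfold C_complete_lim; simpl.
  apply R_complete_lim_full; intros P l hl; destruct hn; exists l; exact hl.
Qed.

Lemma CInt_pair (g : R -> C) (A B : R -> R) (p q : R) :
  p < q -> (forall y, continuous A y) -> (forall y, continuous B y) ->
  (forall y, p < y < q -> g y = (A y, B y)) ->
  CInt g p q = (RInt A p q, RInt B p q).
Proof.
intros hpq hA hB hg; unfold CInt.
apply (is_RInt_unique (V := C_R_CompleteNormedModule)).
apply (is_RInt_ext (fun y => (A y, B y) : C_R_NormedModule)).
- intros y; rewrite Rmin_left, Rmax_right by lra; intros hy; symmetry; auto.
- apply (is_RInt_fct_extend_pair (U := R_NormedModule) (V := R_NormedModule)); simpl;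
    apply (RInt_correct (V := R_CompleteNormedModule)),
      (ex_RInt_continuous (V := R_CompleteNormedModule)); auto.
Qed.

Lemma filterlim_C_pair {T : Type} (F : (T -> Prop) -> Prop) {FF : Filter F}
    (p q : T -> R) (lp lq : R) :
  filterlim p F (locally lp) -> filterlim q F (locally lq) ->
  filterlim (fun s => (p s, q s)) F
    (locally ((lp, lq) : C_R_CompleteNormedModule)).
Proof.
intros hp hq; eapply filterlim_filter_le_2; [|exact (filterlim_pair _ _ hp hq)].
intros P [e He]; exists (ball lp e) (ball lq e); try apply locally_ball.
intros x y h1 h2; apply He; split; assumption.
Qed.

(** [iota] returns the limit because limits along the proper filter [at_left x] are unique. [g] is
    free at [x]; [p] and [q] supply its continuous extension. *)
Lemma left_lim_pair (g : R -> C) (p q : R -> R) (e x : R) :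
  e < x -> continuous p x -> continuous q x ->
  (forall y, e < y < x -> g y = (p y, q y)) ->
  left_lim g x = (p x, q x).
Proof.
intros hex hp hq hg; unfold left_lim.
apply (iota_filterlim_locally (V := C_R_CompleteNormedModule) (F := at_left x)).
assert (hd : 0 < x - e) by lra.
apply (filterlim_ext_loc (fun y => (p y, q y))).
- exists (mkposreal _ hd); intros y hy hyx; symmetry; apply hg.
  change (Rabs (y - x) < x - e) in hy; apply Rabs_def2 in hy; lra.
- apply filterlim_C_pair; try apply at_left_proper_filter;
    eapply filterlim_filter_le_1; try eassumption; apply filter_le_within.
Qed.

Lemma right_lim_pair (g : R -> C) (p q : R -> R) (x e : R) :
  x < e -> continuous p x -> continuous q x ->
  (forall y, x < y < e -> g y = (p y, q y)) ->
  right_lim g x = (p x, q x).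
Proof.
intros hex hp hq hg; unfold right_lim.
apply (iota_filterlim_locally (V := C_R_CompleteNormedModule) (F := at_right x)).
assert (hd : 0 < e - x) by lra.
apply (filterlim_ext_loc (fun y => (p y, q y))).
- exists (mkposreal _ hd); intros y hy hyx; symmetry; apply hg.
  change (Rabs (y - x) < e - x) in hy; apply Rabs_def2 in hy; lra.
- apply filterlim_C_pair; try apply at_right_proper_filter;
    eapply filterlim_filter_le_1; try eassumption; apply filter_le_within.
Qed.

Lemma CDerive_pair (g : R -> C) (p q p1 q1 : R -> R) (x0 x1 : R) :
  (forall y, is_derive p y (p1 y)) -> (forall y, is_derive q y (q1 y)) ->
  (forall y, x0 < y < x1 -> g y = (p y, q y)) ->
  forall y, x0 < y < x1 -> CDerive g y = (p1 y, q1 y).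
Proof.
intros hp hq hg y hy; unfold CDerive.
assert (L : locally y (fun z => x0 < z < x1)).
{ apply (open_and _ _ (open_gt x0) (open_lt x1)); exact hy. }
f_equal; (etransitivity; [apply Derive_ext_loc|apply is_derive_unique; auto]);
  generalize L; apply filter_imp; intros z hz; rewrite (hg z hz); reflexivity.
Qed.

(** Two derivatives are what the scheme takes of a test function; continuity of the second one makes
    it integrable. *)
Lemma polynomial_C2 (c : nat -> R) (n : nat) :
  exists p1 p2 : R -> R,
    (forall y, is_derive (fun y => sum_f_R0 (fun i => c i * y ^ i) n) y (p1 y)) /\
    (forall y, is_derive p1 y (p2 y)) /\ (forall y, continuous p2 y).
Proof.
induction n as [|n [p1 [p2 [h1 [h2 h3]]]]].
- exists (fun _ => 0), (fun _ => 0); (split; [|split]); intros y; simpl.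
  + apply (is_derive_const (c 0%nat * 1)).
  + apply (is_derive_const 0).
  + apply continuous_const.
(* For [n = 0] the exponent [pred n] is harmless, since its factor [INR n] vanishes. *)
- exists (fun y => p1 y + c (S n) * (INR (S n) * y ^ n)),
    (fun y => p2 y + c (S n) * (INR (S n) * (INR n * y ^ pred n))); (split; [|split]); intros y.
  + apply (is_derive_plus (fun y => sum_f_R0 (fun i => c i * y ^ i) n)); [apply h1|].
    auto_derive; [exact I|].
    change (match n with 0%nat => 1 | S _ => INR n + 1 end) with (INR (S n)); ring.
  + apply (is_derive_plus p1); [apply h2|].
    auto_derive; [exact I|].
    change (match n with 0%nat => 1 | S _ => INR n + 1 end) with (INR (S n)); ring.
  + apply (continuous_plus p2); [apply h3|].
    apply (ex_derive_continuous (V := R_NormedModule)); auto_derive; exact I.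
Qed.

Lemma Cconj_sum_n (c : nat -> C) (y : R) (n : nat) :
  sum_n (fun i => Cconj (c i) * RtoC y ^ i)%C n
  = Cconj (sum_n (fun i => c i * RtoC y ^ i)%C n).
Proof.
induction n as [|n IH]; [rewrite !sum_O|rewrite !sum_Sn, IH];
  rewrite <- ?RtoC_pow; unfold plus, Cconj; simpl;
  apply injective_projections; simpl; ring.
Qed.

(** Powers of the real variable [y] are fixed by conjugation, which thus acts on the coefficients
    only. This makes the conjugate of the solution an admissible test function. *)
Lemma in_Vh_Cconj {a b : R} (M : mesh a b) (k : nat) (w : R -> C) :
  in_Vh M k w -> in_Vh M k (fun y => Cconj (w y)).
Proof.
intros hw j hj; destruct (hw j hj) as [c hc].
exists (fun i => Cconj (c i)); intros y hy.
rewrite (hc y hy), Cconj_sum_n; reflexivity.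
Qed.

(** * Energy balance on a cell and dissipation at an interface *)

Section Cell.

Context {a b : R} (M : mesh a b).
Variables (alpha1 alpha2 beta1 beta2 : C) (w : R -> C).

(** Rightward flux of half the energy through interface [i], seen from the cell on its left;
    [energy_flux_p] is the same seen from the right. The first product is the boundary term of the
    integral of [Im (w conj(w)_xx)], the others are the numerical fluxes tested with [conj w]. *)
Definition energy_flux_m (i : nat) : R :=
  Im (trace_m M w i * Cconj (trace_m M (CDerive w) i)
      - flux_u M alpha2 beta2 w i * Cconj (trace_m M (CDerive w) i)
      + flux_ux M alpha1 beta1 w i * Cconj (trace_m M w i))%C.

Definition energy_flux_p (i : nat) : R :=
  Im (trace_p M w i * Cconj (trace_p M (CDerive w) i)
      - flux_u M alpha2 beta2 w i * Cconj (trace_p M (CDerive w) i)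
      + flux_ux M alpha1 beta1 w i * Cconj (trace_p M w i))%C.

Lemma trace_m_pair (g : R -> C) (p q : R -> R) (j : nat) :
  (j < cells M)%nat -> (forall y, continuous p y) -> (forall y, continuous q y) ->
  (forall y, in_cell M j y -> g y = (p y, q y)) ->
  trace_m M g (S j) = (p (node M (S j)), q (node M (S j))).
Proof.
intros hj hp hq hg; unfold trace_m; simpl Nat.eqb; cbv iota.
apply (left_lim_pair g p q (node M j)); auto; apply node_lt; exact hj.
Qed.

Lemma trace_p_pair (g : R -> C) (p q : R -> R) (j : nat) :
  (j < cells M)%nat -> (forall y, continuous p y) -> (forall y, continuous q y) ->
  (forall y, in_cell M j y -> g y = (p y, q y)) ->
  trace_p M g j = (p (node M j), q (node M j)).
Proof.
intros hj hp hq hg; unfold trace_p.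
replace (Nat.eqb j (cells M)) with false by (symmetry; apply Nat.eqb_neq; lia).
apply (right_lim_pair g p q _ (node M (S j))); auto; apply node_lt; exact hj.
Qed.

(* The scheme tested with [conj w]: [Im (w conj(w)_xx)] is the derivative of
   [Im (w conj(w)_x)], and the nonlinear term is real. *)
Lemma cell_energy_balance (f : R -> R) (k j : nat) (wt : R -> C) (A B : R -> R) :
  (j < cells M)%nat -> in_Vh M k w ->
  (forall y, continuous A y) -> (forall y, continuous B y) ->
  (forall y, in_cell M j y -> wt y = (A y, B y)) ->
  (forall v, in_Vh M k v ->
     scheme_lhs M f alpha1 alpha2 beta1 beta2 w wt v j = RtoC 0) ->
  RInt (fun y => 2 * A y * Re (w y)) (node M j) (node M (S j))
  + RInt (fun y => 2 * B y * Im (w y)) (node M j) (node M (S j))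
  = 2 * (energy_flux_p j - energy_flux_m (S j)).
Proof.
intros hj hw hA hB hwt hs.
specialize (hs _ (in_Vh_Cconj M k w hw)).
destruct (hw j hj) as [c hc].
destruct (polynomial_C2 (fun i => Re (c i)) k) as [p1 [p2 [hp [hp1 hp2]]]].
destruct (polynomial_C2 (fun i => Im (c i)) k) as [q1 [q2 [hq [hq1 hq2]]]].
set (p := fun y : R => sum_f_R0 (fun i => Re (c i) * y ^ i) k) in *.
set (q := fun y : R => sum_f_R0 (fun i => Im (c i) * y ^ i) k) in *.
assert (hwp : forall y, in_cell M j y -> w y = (p y, q y)).
{ intros y hy; rewrite (hc y hy); destruct (Re_sum_n c y k) as [hr hi].
  unfold p, q; rewrite <- hr, <- hi; apply surjective_pairing. }
set (v := fun y => Cconj (w y)) in *.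
assert (hv : forall y, in_cell M j y -> v y = (p y, - q y)).
{ intros y hy; unfold v; rewrite (hwp y hy); reflexivity. }
assert (hnq : forall y, is_derive (fun y => - q y) y (- q1 y))
  by (intros y; apply (is_derive_opp q); auto).
assert (hnq1 : forall y, is_derive (fun y => - q1 y) y (- q2 y))
  by (intros y; apply (is_derive_opp q1); auto).
assert (hlt := node_lt _ _ M j hj).
assert (hwx := CDerive_pair w p q p1 q1 _ _ hp hq hwp).
assert (hvx := CDerive_pair v p _ p1 _ _ _ hp hnq hv).
assert (hvxx := CDerive_pair _ p1 _ p2 _ _ _ hp1 hnq1 hvx).
assert (dc : forall g g' : R -> R, (forall y, is_derive g y (g' y)) ->
               forall y, continuous g y).
{ intros g g' hg y; apply (ex_derive_continuous (V := R_NormedModule)).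
  exists (g' y); apply hg. }
assert (cp := dc _ _ hp); assert (cq := dc _ _ hq); assert (cp1 := dc _ _ hp1).
assert (cq1 := dc _ _ hq1); assert (cnq := dc _ _ hnq); assert (cnq1 := dc _ _ hnq1).
assert (cm : forall g h : R -> R, (forall y, continuous g y) -> (forall y, continuous h y) ->
               forall y, continuous (fun y => g y * h y) y)
  by (intros g h hg hh y; apply (continuous_mult g h); auto).
assert (ca : forall g h : R -> R, (forall y, continuous g y) -> (forall y, continuous h y) ->
               forall y, continuous (fun y => g y + h y) y)
  by (intros g h hg hh y; apply (continuous_plus g h); auto).
assert (cs : forall g h : R -> R, (forall y, continuous g y) -> (forall y, continuous h y) ->
               forall y, continuous (fun y => g y - h y) y)
  by (intros g h hg hh y; apply (continuous_minus g h); auto).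
assert (ei : forall g : R -> R, (forall y, continuous g y) ->
               forall x y, ex_RInt g x y)
  by (intros g hg x y; apply (ex_RInt_continuous (V := R_CompleteNormedModule)); auto).
(* The scheme multiplies this integral by [Ci], so its real part, half the time derivative of the
   cell energy, enters the imaginary part of the equation. *)
assert (E1 : CInt (fun y => wt y * v y)%C (node M j) (node M (S j))
   = (RInt (fun y => A y * p y + B y * q y) (node M j) (node M (S j)),
      RInt (fun y => B y * p y - A y * q y) (node M j) (node M (S j)))).
{ apply CInt_pair; auto.
  intros y hy; rewrite (hwt y hy), (hv y hy); unfold Cmult; simpl; f_equal; ring. }
assert (E2 : Im (CInt (fun y => w y * CDerive (CDerive v) y)%C (node M j) (node M (S j)))
   = (q (node M (S j)) * p1 (node M (S j)) - p (node M (S j)) * q1 (node M (S j)))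
     - (q (node M j) * p1 (node M j) - p (node M j) * q1 (node M j))).
{ rewrite (CInt_pair _ (fun y => p y * p2 y + q y * q2 y)
             (fun y => q y * p2 y - p y * q2 y)); auto.
  - apply (is_RInt_unique (V := R_CompleteNormedModule)).
    apply (is_RInt_derive (V := R_CompleteNormedModule)
             (fun y => q y * p1 y - p y * q1 y)).
    + intros y _.
      replace (q y * p2 y - p y * q2 y) with
        ((q1 y * p1 y + q y * p2 y) - (p1 y * q1 y + p y * q2 y)) by ring.
      apply (is_derive_minus (fun y => q y * p1 y) (fun y => p y * q1 y));
        [apply (is_derive_mult q p1)|apply (is_derive_mult p q1)]; auto; apply Rmult_comm.
    + intros y _; apply (cs (fun y => q y * p2 y)); auto.
  - intros y hy; rewrite (hwp y hy), (hvxx y hy); unfold Cmult; simpl; f_equal; ring. }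
(* As [f] is arbitrary, the integrand may fail to be integrable. Only its realness is used, which
   holds because [w * v] is [|w|^2]. *)
assert (E3 : Im (CInt (fun y => RtoC (f (Cmod (w y) ^ 2)%R) * w y * v y)%C
                   (node M j) (node M (S j))) = 0).
{ apply CInt_real; intros y; unfold v; destruct (w y) as [r s]; simpl; ring. }
assert (E4 : RInt (fun y => 2 * A y * Re (w y)) (node M j) (node M (S j))
  + RInt (fun y => 2 * B y * Im (w y)) (node M j) (node M (S j))
  = 2 * RInt (fun y => A y * p y + B y * q y) (node M j) (node M (S j))).
{ rewrite (RInt_plus (V := R_CompleteNormedModule) (fun y => A y * p y)
             (fun y => B y * q y)) by auto.
  rewrite (RInt_ext (V := R_CompleteNormedModule) (fun y => 2 * A y * Re (w y))
             (fun y => 2 * (A y * p y))).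
  - rewrite (RInt_ext (V := R_CompleteNormedModule) (fun y => 2 * B y * Im (w y))
             (fun y => 2 * (B y * q y))).
    + rewrite (RInt_scal (V := R_CompleteNormedModule) (fun y => A y * p y)) by auto.
      rewrite (RInt_scal (V := R_CompleteNormedModule) (fun y => B y * q y)) by auto.
      unfold plus, scal; simpl; unfold mult; simpl; ring.
    + intros y; rewrite Rmin_left, Rmax_right by lra; intros hy.
      rewrite (hwp y hy); simpl; ring.
  - intros y; rewrite Rmin_left, Rmax_right by lra; intros hy.
    rewrite (hwp y hy); simpl; ring. }
rewrite E4; clear E4.
unfold scheme_lhs in hs; apply (f_equal Im) in hs.
unfold energy_flux_m, energy_flux_p.
rewrite E1 in hs.
rewrite (trace_m_pair v p (fun y => - q y)), (trace_p_pair v p (fun y => - q y)),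
  (trace_m_pair (CDerive v) p1 (fun y => - q1 y)),
  (trace_p_pair (CDerive v) p1 (fun y => - q1 y)) in hs by auto.
rewrite (trace_m_pair w p q), (trace_p_pair w p q), (trace_m_pair (CDerive w) p1 q1),
  (trace_p_pair (CDerive w) p1 q1) by auto.
set (I2 := CInt (fun y => w y * CDerive (CDerive v) y)%C _ _) in *.
set (I3 := CInt (fun y => _ * w y * v y)%C _ _) in *.
(* The balance is linear in the four flux values and holds whatever they are; their formulas matter
   only for the sign at an interface. *)
generalize dependent (flux_u M alpha2 beta2 w j); intros F1.
generalize dependent (flux_u M alpha2 beta2 w (S j)); intros F2.
generalize dependent (flux_ux M alpha1 beta1 w j); intros F3.
generalize dependent (flux_ux M alpha1 beta1 w (S j)); intros F4 hs.
clearbody I2 I3.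
destruct I2 as [I2r I2i], I3 as [I3r I3i], F1, F2, F3, F4.
unfold Re, Im, Cconj, Cmult, Cplus, Cminus, Copp in *; simpl in *.
lra.
Qed.

(** The jump of [w conj(w_x)] is [{w} conj[w_x] + [w] conj{w_x}]. The averages in the fluxes cancel
    the first term and complete the second to a real number, so only the parameter terms survive.
    They form a Hermitian form in [[w]] and [[w_x]], whose sign is decided by its discriminant. *)
Lemma interface_dissipation (i : nat) :
  flux_condition alpha1 alpha2 beta1 beta2 ->
  energy_flux_p i <= energy_flux_m i.
Proof.
intros [hb2 [hb1 hc]]; unfold energy_flux_p, energy_flux_m, flux_u, flux_ux, avg, jump.
generalize (trace_m M w i) (trace_p M w i)
  (trace_m M (CDerive w) i) (trace_p M (CDerive w) i).
intros [x1 y1] [x2 y2] [z1 t1] [z2 t2].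
rewrite Cmod2_alt in hc.
destruct alpha1 as [a1r a1i], alpha2 as [a2r a2i], beta1 as [b1r b1i], beta2 as [b2r b2i].
unfold Re, Im, Cconj, Cmult, Cplus, Cminus, Copp, RtoC in *; simpl in *.
(* In complex notation [W1 + i W2] is [[w]], [P1 + i P2] is [[w_x]] and [c1 + i c2] is
   [alpha1 + conj alpha2]. The left side of [key] is then the imaginary part of their product with
   [[w]] conjugated. *)
set (W1 := x2 - x1); set (W2 := y2 - y1); set (P1 := z2 - z1); set (P2 := t2 - t1).
set (c1 := a1r + a2r) in *; set (c2 := a1i - a2i).
replace (a1i + - a2i) with c2 in hc by (unfold c2; ring).
assert (key : c1 * (P2 * W1 - P1 * W2) + c2 * (P1 * W1 + P2 * W2)
              <= b2i * (P1 ^ 2 + P2 ^ 2) - b1i * (W1 ^ 2 + W2 ^ 2)).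
{ set (P := P1 ^ 2 + P2 ^ 2); set (W := W1 ^ 2 + W2 ^ 2).
  assert (hP : 0 <= P) by (unfold P; nra).
  assert (hW : 0 <= W) by (unfold W; nra).
  assert (hPW : 0 <= P * W) by (apply Rmult_le_pos; assumption).
  assert (hY : 0 <= b2i * P - b1i * W).
  { pose proof (Rmult_le_pos _ _ hb2 hP); pose proof (Rmult_le_pos (- b1i) W); lra. }
  apply Rsqr_incr_0_var; [|exact hY].
  apply Rle_trans with ((c1 ^ 2 + c2 ^ 2) * (P * W)).
  - (* Cauchy-Schwarz, with defect the square of the conjugate combination *)
    replace ((c1 ^ 2 + c2 ^ 2) * (P * W)) with
      (Rsqr (c1 * (P2 * W1 - P1 * W2) + c2 * (P1 * W1 + P2 * W2))
       + Rsqr (c1 * (P1 * W1 + P2 * W2) - c2 * (P2 * W1 - P1 * W2)))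
      by (unfold P, W, Rsqr; ring).
    pose proof (Rle_0_sqr (c1 * (P1 * W1 + P2 * W2) - c2 * (P2 * W1 - P1 * W2))); lra.
  - apply Rle_trans with (- 4 * b1i * b2i * (P * W)).
    + apply Rmult_le_compat_r; [exact hPW|lra].
    (* Arithmetic-geometric mean: [(b2i P - b1i W)^2 + 4 b1i b2i P W = (b2i P + b1i W)^2]. *)
    + pose proof (Rle_0_sqr (b2i * P + b1i * W)); unfold Rsqr in *; lra. }
unfold W1, W2, P1, P2, c1, c2 in key; lra.
Qed.

(** Both indices take the left trace at the last node and the right trace at the first one. This
    closes the telescoping sum over the cells. *)
Lemma energy_flux_p_periodic : energy_flux_p 0 = energy_flux_p (cells M).
Proof.
assert (hc := cells_pos _ _ M).
assert (e0 : Nat.eqb 0 (cells M) = false) by (apply Nat.eqb_neq; lia).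
assert (e1 : Nat.eqb (cells M) 0 = false) by (apply Nat.eqb_neq; lia).
unfold energy_flux_p, flux_u, flux_ux, avg, jump, trace_p, trace_m.
rewrite e0, e1, !Nat.eqb_refl; reflexivity.
Qed.

End Cell.

(** * Summation over the cells and stability *)

Lemma ex_RInt_cell_energy {a b : R} (M : mesh a b) (k : nat) (w : R -> C) (j : nat) :
  in_Vh M k w -> (j < cells M)%nat ->
  ex_RInt (fun y => Re (w y) ^ 2) (node M j) (node M (S j)) /\
  ex_RInt (fun y => Im (w y) ^ 2) (node M j) (node M (S j)).
Proof.
intros hw hj; destruct (hw j hj) as [c hc].
assert (hlt := node_lt _ _ M j hj).
assert (E : forall d : nat -> R, ex_RInt (fun y => sum_f_R0 (fun i => d i * y ^ i) k ^ 2)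
                                  (node M j) (node M (S j))).
{ intros d; apply (ex_RInt_continuous (V := R_CompleteNormedModule)); intros z _.
  destruct (polynomial_C2 d k) as [p1 [_ [hp _]]].
  apply (ex_derive_continuous (V := R_NormedModule)).
  eexists; apply (is_derive_pow (fun y => sum_f_R0 (fun i => d i * y ^ i) k) 2 z _ (hp z)). }
split; [apply (ex_RInt_ext _ _ _ _) with (2 := E (fun i => Re (c i)))
       |apply (ex_RInt_ext _ _ _ _) with (2 := E (fun i => Im (c i)))];
  intros y; rewrite Rmin_left, Rmax_right by lra; intros hy;
  rewrite (hc y hy); destruct (Re_sum_n c y k) as [hr hi]; rewrite ?hr, ?hi; reflexivity.
Qed.

Lemma ex_RInt_cell_Cmod {a b : R} (M : mesh a b) (k : nat) (w : R -> C) (j : nat) :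
  in_Vh M k w -> (j < cells M)%nat ->
  ex_RInt (fun y => Cmod (w y) ^ 2) (node M j) (node M (S j)).
Proof.
intros hw hj; destruct (ex_RInt_cell_energy M k w j hw hj) as [hr hi].
apply (ex_RInt_ext (fun y => Re (w y) ^ 2 + Im (w y) ^ 2)).
- intros y _; symmetry; apply Cmod2_alt.
- apply (ex_RInt_plus (V := R_NormedModule)); assumption.
Qed.

Lemma ex_RInt_Cmod {a b : R} (M : mesh a b) (k : nat) (w : R -> C) (m : nat) :
  in_Vh M k w -> (m <= cells M)%nat ->
  ex_RInt (fun y => Cmod (w y) ^ 2) (node M 0) (node M m).
Proof.
intros hw; induction m as [|m IH]; intros hm; [apply ex_RInt_point|].
apply ex_RInt_Chasles with (node M m); [apply IH; lia|].
apply (ex_RInt_cell_Cmod M k); [exact hw|lia].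
Qed.

(** Writing [|u|^2] as the sum of the squares of the real and imaginary parts reduces the derivative
    to two real polynomials; the integrals so obtained are those of [cell_energy_balance]. *)
Lemma cell_energy_derivative {a b : R} (M : mesh a b) (k : nat) (T : R) (f : R -> R)
    (alpha1 alpha2 beta1 beta2 : C) (u : R -> R -> C) (t : R) (j : nat) :
  semidiscrete_solution M k T f alpha1 alpha2 beta1 beta2 u ->
  0 < t <= T -> (j < cells M)%nat ->
  is_derive_within (V := R_NormedModule) (fun s => 0 < s <= T)
    (fun s => RInt (fun y => Cmod (u s y) ^ 2) (node M j) (node M (S j))) t
    (2 * (energy_flux_p M alpha1 alpha2 beta1 beta2 (u t) j
          - energy_flux_m M alpha1 alpha2 beta1 beta2 (u t) (S j))).
Proof.
intros [ut H] ht hj.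
assert (hlt := node_lt _ _ M j hj).
destruct (H t ht) as [hV [hD hs]].
destruct (polynomial_energy_derivative T t _ _ k (fun s y => Re (u s y))
            (fun y => Re (ut t y)) ht hlt) as [A [hA [hrA dA]]].
{ intros s hs'; destruct (H s hs') as [hVs _]; destruct (hVs j hj) as [c hc].
  exists (fun i => Re (c i)); intros y hy; rewrite (hc y hy); apply Re_sum_n. }
{ intros y hy; exact (proj1 (is_derive_within_Re_Im _ _ _ _ (hD j y hj hy))). }
destruct (polynomial_energy_derivative T t _ _ k (fun s y => Im (u s y))
            (fun y => Im (ut t y)) ht hlt) as [B [hB [hrB dB]]].
{ intros s hs'; destruct (H s hs') as [hVs _]; destruct (hVs j hj) as [c hc].
  exists (fun i => Im (c i)); intros y hy; rewrite (hc y hy); apply Re_sum_n. }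
{ intros y hy; exact (proj2 (is_derive_within_Re_Im _ _ _ _ (hD j y hj hy))). }
rewrite <- (cell_energy_balance M alpha1 alpha2 beta1 beta2 (u t) f k j (ut t) A B); auto.
- refine (is_derive_within_ext _ _ ht _ _ _ _
            (is_derive_within_plus _ _ _ _ _ _ dA dB)).
  intros s hs'; destruct (H s hs') as [hVs _].
  destruct (ex_RInt_cell_energy M k (u s) j hVs hj) as [hr hi].
  rewrite (RInt_ext (V := R_CompleteNormedModule) (fun y => Cmod (u s y) ^ 2)
             (fun y => Re (u s y) ^ 2 + Im (u s y) ^ 2)) by (intros; apply Cmod2_alt).
  symmetry; apply (RInt_plus (V := R_CompleteNormedModule)); assumption.
- intros y hy; rewrite <- hrA, <- hrB by exact hy; apply surjective_pairing.
Qed.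

Lemma L2_stability {a b : R} (M : mesh a b) (k : nat) (T : R) (f : R -> R)
    (alpha1 alpha2 beta1 beta2 : C) (u : R -> R -> C) :
  semidiscrete_solution M k T f alpha1 alpha2 beta1 beta2 u ->
  flux_condition alpha1 alpha2 beta1 beta2 -> L2_stable a b T u.
Proof.
intros hu hc t ht.
pose (Gp := energy_flux_p M alpha1 alpha2 beta1 beta2 (u t)).
(* The partial sums telescope: cell [m] adds [Gp m] minus the flux on the left side of interface
   [S m], doubled, and dissipation bounds this by [2 * (Gp m - Gp (S m))]. At [m = cells M]
   periodicity makes the total bound zero. *)
assert (S_m : forall m, (m <= cells M)%nat -> exists d : R,
  is_derive_within (V := R_NormedModule) (fun s => 0 < s <= T)
    (fun s => RInt (fun y => Cmod (u s y) ^ 2) (node M 0) (node M m)) t d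
  /\ d <= 2 * (Gp 0%nat - Gp m)).
{ induction m as [|m IH]; intros hm.
  - exists 0; split; [|lra].
    refine (is_derive_within_ext _ _ ht _ _ _ _ (is_derive_within_const _ _ 0)).
    intros s _; rewrite RInt_point; reflexivity.
  - destruct IH as [d [hd hle]]; [lia|].
    assert (hm' : (m < cells M)%nat) by lia.
    assert (hcell := cell_energy_derivative M k T f _ _ _ _ u t m hu ht hm').
    eexists; split.
    + refine (is_derive_within_ext _ _ ht _ _ _ _
                (is_derive_within_plus _ _ _ _ _ _ hd hcell)).
      intros s hs; destruct hu as [ut H]; destruct (H s hs) as [hVs _].
      apply (RInt_Chasles (V := R_CompleteNormedModule));
        [apply (ex_RInt_Cmod M k)|apply (ex_RInt_cell_Cmod M k)]; auto; lia.
    + assert (hi := interface_dissipation M alpha1 alpha2 beta1 beta2 (u t) (S m) hc).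
      unfold Gp in *; lra. }
destruct (S_m (cells M) (le_n _)) as [d [hd hle]].
exists d; split.
- rewrite (node_first _ _ M), (node_last _ _ M) in hd; exact hd.
- unfold Gp in hle; rewrite <- energy_flux_p_periodic in hle; lra.
Qed.

Theorem theorem2p1 (a b T : R) (M : mesh a b) (k : nat) (f : R -> R)
    (alpha1 alpha2 beta1 beta2 : C)
    (hk : (1 <= k)%nat) (hT : (0 < T)%R) :
  (forall u : R -> R -> C,
     semidiscrete_solution M k T f alpha1 alpha2 beta1 beta2 u ->
     flux_condition alpha1 alpha2 beta1 beta2 ->
     L2_stable a b T u) /\
  (Im alpha1 = 0%R -> Im alpha2 = 0%R -> Im beta1 = 0%R -> Im beta2 = 0%R ->
   (flux_condition alpha1 alpha2 beta1 beta2 <->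
    (alpha1 + alpha2)%C = RtoC 0)).
Proof.
split; [intros u; apply L2_stability|].
intros h1 h2 h3 h4; unfold flux_condition; rewrite Cmod2_alt, h3, h4.
destruct alpha1 as [x1 y1], alpha2 as [x2 y2].
unfold Re, Im, RtoC, Cplus, Cconj in *; simpl in *; subst y1 y2.
split.
- intros [_ [_ h]].
  (* For real parameters the discriminant condition reads [(x1 + x2)^2 <= 0]. *)
  assert (e : x1 + x2 = 0) by nra.
  f_equal; lra.
- intros e; injection e; intros _ e'; rewrite e'; lra.
Qed.
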